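(* 1. If the VC-dimension of a set system is less than or equal to $1$, then its additionality is less than or equal to $1$. So every set system with additionality $2$ has VC-dimension at least $2$. 2. The VC-dimension of every well-graded family with additionality $2$ is equal to $2$.
   Context: A set system $(X,\mathcal{F})$ is a finite set $X$ together with a nonempty family $\mathcal{F}$ of distinct subsets of $X$. Its one-inclusion graph $G_{\mathcal{F}}$ has a vertex $v_A$ for each $A\in\mathcal{F}$, with an edge (directed from $v_A$ to $v_B$, labelled $b$) whenever $B=A\cup\{b\}$ for some $b\in X\setminus A$. The system is a well-graded family if for all $A,B\in\mathcal{F}$ the distance between $v_A$ and $v_B$ in the underlying undirected graph of $G_{\mathcal{F}}$ equals $|A\triangle B|$ (infinite distance if there is no path). An element $x\in X$ is essential if there are $A,B\in\mathcal{F}$ with $x\in A$, $x\notin B$; $ess_{\mathcal{F}}(X)$ is the set of essential elements, and the additionality is $|\mathcal{F}|-|ess_{\mathcal{F}}(X)|$. The VC-dimension is the largest size of a set $Y\subseteq X$ such that $\{A\cap Y:A\in\mathcal{F}\}$ is the full power set of $Y$. *)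

(* Defs.v *)
From mathcomp Require Import all_boot all_order all_algebra.

Set Implicit Arguments.
Unset Strict Implicit.
Unset Printing Implicit Defensive.

Section Distance.

Variables (V : finType) (e : rel V).

Definition has_walk (u v : V) (n : nat) : bool :=
  [exists p : n.-tuple V, path e u p && (last u p == v)].

Lemma connect_has_walk (u v : V) : connect e u v -> exists n, has_walk u v n.
Proof.
case/connectP=> p e_p ->; exists (size p).
by apply/existsP; exists (in_tuple p); rewrite e_p eqxx.
Qed.

(* Length of a shortest walk from u to v; None is the infinite distance. *)
Definition gdist (u v : V) : option nat :=
  match @idP (connect e u v) with
  | ReflectT uv => Some (ex_minn (connect_has_walk uv))
  | ReflectF _ => None
  end.

End Distance.

Section SetSystem.

Variables (X : finType) (F : {set {set X}}).

Definition oig_vertex : finType := {A : {set X} | A \in F}.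

(* The directed edge from u to v labelled b; b \notin val u makes it loopless. *)
Definition oig_edge (b : X) (u v : oig_vertex) : bool :=
  (b \notin val u) && (val v == b |: val u).

(* Adjacency in the underlying undirected graph. *)
Definition oig_adj : rel oig_vertex :=
  [rel u v | [exists b, oig_edge b u v || oig_edge b v u]].

Definition symdiff (A B : {set X}) : {set X} := (A :\: B) :|: (B :\: A).

Definition well_graded : Prop :=
  forall u v : oig_vertex,
    gdist oig_adj u v = Some #|symdiff (val u) (val v)|.

Definition essential (x : X) : bool :=
  [exists A in F, [exists B in F, (x \in A) && (x \notin B)]].

Definition ess : {set X} := [set x | essential x].

(* An integer, since truncated subtraction would be wrong here: the system
   {set0, X} with X nonempty has additionality 2 - #|X|. *)
Definition additionality : int := (#|F|%:Z - #|ess|%:Z)%R.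

Definition shattered (Y : {set X}) : bool :=
  [set A :&: Y | A in F] == powerset Y.

(* For nonempty F the maximum is over a nonempty set: set0 is shattered. *)
Definition vc_dim : nat := \max_(Y : {set X} | shattered Y) #|Y|.

End SetSystem.

(* Main.v *)
Require Import Defs.
From mathcomp Require Import all_boot all_order all_algebra.
From mathcomp Require Import zify.

(** Part 1: a set system has at least as many shattered sets as members (Pajor),
    and when the VC-dimension is at most 1 the only candidates for shattered
    sets are the empty set and the singletons of essential elements.

    Part 2: in a well-graded family every essential element labels an edge,
    because a path between two members separated by [x] must cross [x].  The
    two ends of an edge labelled [x] have the same trace on any [Z] not
    containing [x] but distinct traces on [x |: Z], so enlarging [Z] by an
    essential element increases the number of traces.  Starting from a shattered
    [Y] this gives [2 ^ #|Y| + #|ess F| - #|Y| <= #|F| = #|ess F| + 2], hence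
    [#|Y| <= 2]. *)

Set Implicit Arguments.
Unset Strict Implicit.
Unset Printing Implicit Defensive.

Section Shattering.

Variable X : finType.
Implicit Types (F G : {set {set X}}) (A B S T Y Z : {set X}) (x : X).

(** * Basic properties of shattered sets *)

Lemma shatteredP F Y :
  reflect (forall T, T \subset Y -> exists2 A, A \in F & A :&: Y = T)
          (shattered F Y).
Proof.
apply: (iffP eqP) => [shY T sTY | shY].
  have: T \in powerset Y by rewrite powersetE.
  by rewrite -shY => /imsetP[A FA ->]; exists A.
apply/setP=> T; rewrite powersetE; apply/imsetP/idP => [[A _ ->] | sTY].
  exact: subsetIr.
by have [A FA <-] := shY T sTY; exists A.
Qed.

Lemma shatteredS F G Y : F \subset G -> shattered F Y -> shattered G Y.
Proof.
move=> sFG /shatteredP shY; apply/shatteredP=> T sTY.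
by have [A FA <-] := shY T sTY; exists A => //; apply: (subsetP sFG).
Qed.

Lemma shattered0 F : F != set0 -> shattered F set0.
Proof.
case/set0Pn=> A FA; apply/shatteredP=> T; rewrite subset0 => /eqP->.
by exists A => //; rewrite setI0.
Qed.

Lemma shattered_sub_ess F Y : shattered F Y -> Y \subset ess F.
Proof.
move/shatteredP=> shY; apply/subsetP=> x Yx; rewrite inE.
have [A FA AY] := shY Y (subxx _); have [B FB BY] := shY set0 (sub0set _).
apply/existsP; exists A; rewrite FA; apply/existsP; exists B; rewrite FB /=.
have Ax : x \in A by move: Yx; rewrite -{1}AY inE => /andP[].
rewrite Ax; apply/negP=> Bx.
by have := in_set0 x; rewrite -BY inE Bx Yx.
Qed.

Lemma card_leq_vc_dim F Y : shattered F Y -> #|Y| <= vc_dim F.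
Proof. by move=> shY; rewrite /vc_dim (leq_bigmax_cond (F := fun Z => #|Z|)). Qed.

(** * Pajor's inequality, by splitting a family at an element *)

Definition with_elt F x := [set A in F | x \in A].
Definition without_elt F x := [set A in F | x \notin A].

Lemma card_with_without F x : #|F| = #|with_elt F x| + #|without_elt F x|.
Proof.
rewrite -(cardsID [set A : {set X} | x \in A] F).
by congr (_ + _); apply: eq_card => A; rewrite !inE // andbC.
Qed.

Lemma shattered_with_notin F x Y : shattered (with_elt F x) Y -> x \notin Y.
Proof.
move/shatteredP/(_ set0 (sub0set _))=> [A]; rewrite inE => /andP[_ Ax] AY.
by apply/negP=> Yx; have := in_set0 x; rewrite -AY inE Ax Yx.
Qed.

Lemma shattered_without_notin F x Y :
  shattered (without_elt F x) Y -> x \notin Y.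
Proof.
move/shatteredP/(_ Y (subxx _))=> [A]; rewrite inE => /andP[_ nAx] AY.
by apply: contra nAx; rewrite -{1}AY inE => /andP[].
Qed.

(** A target trace [T] is realised in the half selected by whether [x \in T]: membership of [x] is
    then automatic, and shattering of [Y] takes care of [T :\ x]. *)
Lemma shattered_setU1 F x Y :
  shattered (with_elt F x) Y -> shattered (without_elt F x) Y ->
  shattered F (x |: Y).
Proof.
move=> sh1 sh0; have nYx := shattered_with_notin sh1.
move/shatteredP in sh1; move/shatteredP in sh0.
apply/shatteredP=> T sTxY.
have sTY : T :\ x \subset Y by rewrite subDset.
case Tx: (x \in T); [have [A] := sh1 _ sTY | have [A] := sh0 _ sTY];
  rewrite inE => /andP[FA Ax] AY; exists A => //; apply/setP=> y;
  have [->|neq_yx] := eqVneq y x;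
  rewrite ?inE ?eqxx ?Tx ?Ax ?(negPf Ax) //= (negPf neq_yx) /=;
  by have /setP/(_ y) := AY; rewrite !inE neq_yx.
Qed.

(** Strong induction on [#|F|]: an element [x] separating two members splits [F] into two smaller
    nonempty halves, whose shattered sets are then combined. *)
Lemma card_leq_shattered F : #|F| <= #|[set Y | shattered F Y]|.
Proof.
have [n] := ubnP #|F|; elim: n F => // n IHn F ltFn.
have [F1 | /card_gt1P[A [B [FA FB neqAB]]]] := leqP #|F| 1.
  case: (posnP #|F|) => [-> // | F_gt0]; apply: leq_trans F1 _.
  rewrite card_gt0; apply/set0Pn; exists set0.
  by rewrite inE shattered0 // -card_gt0.
have [x neqx] : exists x, (x \in A) != (x \in B).
  apply/existsP; rewrite -negb_forall; apply: contra neqAB => /forallP eqAB.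
  by apply/eqP/setP=> x; apply/eqP.
set F1 := with_elt F x; set F0 := without_elt F x.
have cardF : #|F| = #|F1| + #|F0| := card_with_without F x.
have F1_gt0 : 0 < #|F1|.
  by apply/card_gt0P; case Ax: (x \in A) neqx => neqx;
     [exists A | exists B]; rewrite inE ?FA ?FB //=; case: (x \in B) neqx.
have F0_gt0 : 0 < #|F0|.
  by apply/card_gt0P; case Ax: (x \in A) neqx => neqx;
     [exists B | exists A]; rewrite inE ?FA ?FB ?Ax //=; case: (x \in B) neqx.
have /IHn le1 : #|F1| < n by lia.
have /IHn le0 : #|F0| < n by lia.
set S1 := [set Y | shattered F1 Y] in le1.
set S0 := [set Y | shattered F0 Y] in le0.
have notin1 Y : Y \in S1 -> x \notin Y.
  by rewrite inE => /shattered_with_notin.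
have notin0 Y : Y \in S0 -> x \notin Y.
  by rewrite inE => /shattered_without_notin.
(* A set shattered by both halves counts twice in [#|S1| + #|S0|]; adding [x] to it yields a second
   set shattered by [F], and a new one, since nothing in [S1] or [S0] contains [x]. *)
set S2 := [set x |: Y | Y in S1 :&: S0].
have card2 : #|S2| = #|S1 :&: S0|.
  apply: card_in_imset => Y Z /setIP[/notin1 nYx _] /setIP[/notin1 nZx _] eqYZ.
  by rewrite -(setU1K nYx) eqYZ setU1K.
have disj : [disjoint S1 :|: S0 & S2].
  rewrite -setI_eq0 -subset0; apply/subsetP=> Y /setIP[S10Y /imsetP[Z _ YE]].
  have: x \notin Y by case/setUP: S10Y => [/notin1|/notin0].
  by rewrite YE setU11.
have sub : (S1 :|: S0) :|: S2 \subset [set Y | shattered F Y].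
  apply/subsetP=> Y /setUP[/setUP[]|/imsetP[Z /setIP[S1Z S0Z] ->]].
  - by rewrite !inE; apply: shatteredS; rewrite /F1 /with_elt setIdE subsetIl.
  - by rewrite !inE; apply: shatteredS; rewrite /F0 /without_elt setIdE subsetIl.
  by move: S1Z S0Z; rewrite !inE; apply: shattered_setU1.
apply: leq_trans (subset_leq_card sub).
have /eqP -> : #|S1 :|: S0 :|: S2| == #|S1 :|: S0| + #|S2|.
  by rewrite (leq_card_setU _ _).
by rewrite card2 cardsUI cardF leq_add.
Qed.

Lemma card_leq_ess_of_vc_dim1 F : vc_dim F <= 1 -> #|F| <= #|ess F|.+1.
Proof.
move=> vc1; apply: leq_trans (card_leq_shattered F) _.
set E := [set [set x] | x in ess F].
have <- : #|set0 |: E| = #|ess F|.+1.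
  rewrite cardsU1 card_imset; last exact: set1_inj.
  suff -> : set0 \notin E by [].
  by apply/imsetP=> -[x _ /setP/(_ x)]; rewrite !inE eqxx.
apply/subset_leq_card/subsetP=> Y; rewrite inE => shY.
have := leq_trans (card_leq_vc_dim shY) vc1.
rewrite leq_eqVlt ltnS leqn0 cards_eq0 => /orP[/cards1P[x YE] | /eqP->].
  have := shattered_sub_ess shY; rewrite YE sub1set => ess_x.
  by rewrite !inE imset_f ?orbT.
by rewrite setU11.
Qed.

(** * Edge labels and traces in well-graded families *)

Lemma gdist_connect (V : finType) (e : rel V) (u v : V) n :
  gdist e u v = Some n -> connect e u v.
Proof. by rewrite /gdist; destruct (@idP (connect e u v)). Qed.

Lemma well_graded_edge F x :
  well_graded F -> x \in ess F ->
  exists A, [/\ A \in F, x \notin A & x |: A \in F].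
Proof.
move=> wgF; rewrite inE => /existsP[A /andP[FA /existsP[B]]].
case/and3P=> FB Ax nBx.
pose u : oig_vertex F := Sub A FA; pose v : oig_vertex F := Sub B FB.
have uv : connect (@oig_adj X F) u v := gdist_connect (wgF u v).
have [/existsP[w /andP[nwx Fxw]] | no_edge] := boolP
    [exists w : oig_vertex F, (x \notin val w) && (x |: val w \in F)].
  by exists (val w); split => //; apply: valP.
(* Without an edge labelled [x], adjacent vertices agree on [x], so [a] is a union of connected
   components and cannot separate [u] from [v]. *)
pose a := [pred w : oig_vertex F | x \in val w].
have step b (w w' : oig_vertex F) : oig_edge b w w' -> (x \in val w) = (x \in val w').
  case/andP=> nwb /eqP w'E; rewrite w'E !inE.
  have [xb | //] := eqVneq x b; case/negP: no_edge; apply/existsP; exists w.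
  by rewrite xb nwb -w'E; apply: valP.
have cl : closed (@oig_adj X F) a.
  by move=> w w' /existsP[b /orP[/step|/step]]; rewrite !inE.
have := closed_connect cl uv; rewrite !inE /= Ax.
by rewrite (negPf nBx).
Qed.

Definition traces F Z := [set A :&: Z | A in F].

Lemma card_traces_setU1 F x Z :
  well_graded F -> x \in ess F -> x \notin Z ->
  #|traces F Z| < #|traces F (x |: Z)|.
Proof.
move=> wgF ess_x nZx; have [A [FA nAx FxA]] := well_graded_edge wgF ess_x.
have restr B : (B :&: (x |: Z)) :&: Z = B :&: Z.
  by rewrite -setIA (setIidPr (subsetUr _ _)).
(* Restriction to [Z] maps the traces on [x |: Z] onto those on [Z]; equal cardinalities would make
   it injective, but it merges the traces of [A] and [x |: A]. *)
have <- : [set B :&: Z | B in traces F (x |: Z)] = traces F Z.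
  by rewrite -imset_comp; apply: eq_imset => B /=.
rewrite ltn_neqAle leq_imset_card andbT; apply/imset_injP=> inj.
have eqA : A :&: (x |: Z) = (x |: A) :&: (x |: Z).
  have tr B : B \in F -> B :&: (x |: Z) \in traces F (x |: Z).
    by move=> FB; apply/imsetP; exists B.
  apply: inj; [exact: tr | exact: tr | rewrite !restr].
  apply/setP=> y; rewrite !inE; have [->|//] := eqVneq y x.
  by rewrite (negPf nZx) !andbF.
by have /setP/(_ x) := eqA; rewrite !inE eqxx (negPf nAx).
Qed.

Lemma card_traces_setU F (D : {set X}) Y :
  well_graded F -> D \subset ess F -> [disjoint D & Y] ->
  #|traces F Y| + #|D| <= #|traces F (D :|: Y)|.
Proof.
move=> wgF; have [n] := ubnP #|D|; elim: n D => // n IHn D ltDn sDess dDY.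
have [->|[x Dx]] := set_0Vmem D; first by rewrite cards0 addn0 set0U.
have cardD := cardsD1 x D; rewrite Dx in cardD.
have sD'D : D :\ x \subset D := subsetDl _ _.
have le' : #|traces F Y| + #|D :\ x| <= #|traces F (D :\ x :|: Y)|.
  apply: IHn; [lia | exact: subset_trans sD'D sDess | exact: disjointWl dDY].
have nx : x \notin D :\ x :|: Y.
  by rewrite !inE eqxx /= (disjointFr dDY Dx).
have := card_traces_setU1 wgF (subsetP sDess x Dx) nx.
by rewrite setUA setD1K // cardD; lia.
Qed.

(** Enlarge [Y] by all of [ess F :\: Y]; the traces on the result number at most [#|F|]. Adding
    [#|Y|] to both sides avoids truncated subtraction. *)
Lemma card_shattered_well_graded F Y :
  well_graded F -> shattered F Y -> 2 ^ #|Y| + #|ess F| <= #|F| + #|Y|.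
Proof.
move=> wgF shY; have sYess := shattered_sub_ess shY.
have dDY : [disjoint ess F :\: Y & Y].
  by rewrite -setI_eq0 setIDAC setDIl setDv setI0.
have := card_traces_setU wgF (subsetDl _ _) dDY.
rewrite /traces (eqP shY) card_powerset.
move/leq_trans/(_ (leq_imset_card _ _)).
rewrite -(cardsID Y (ess F)) (setIidPr sYess).
by rewrite -(leq_add2r #|Y|) -addnA (addnC #|_ :\: _|).
Qed.

End Shattering.

Theorem mainTheorem7 (X : finType) (F : {set {set X}}) (F_neq0 : F != set0) :
  [/\ vc_dim F <= 1 -> (additionality F <= 1)%R,
      (additionality F = 2)%R -> 2 <= vc_dim F
    & well_graded F -> (additionality F = 2)%R -> vc_dim F = 2].
Proof.
have part1 : vc_dim F <= 1 -> (additionality F <= 1)%R.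
  by move/card_leq_ess_of_vc_dim1; rewrite /additionality; lia.
have part1' : (additionality F = 2)%R -> 2 <= vc_dim F.
  move=> add2; rewrite ltnNge; apply/negP=> /part1.
  by rewrite add2.
split=> // wgF add2; apply/eqP; rewrite eqn_leq part1' // andbT.
apply/bigmax_leqP=> Y /(card_shattered_well_graded wgF) leY.
rewrite leqNgt; apply/negP=> Y_gt2.
(* Additionality 2 turns [leY] into [2 ^ #|Y| <= #|Y| + 2], which fails from [#|Y| = 3] on. *)
have pow_gt n : 2 < n -> n.+2 < 2 ^ n.
  elim: n => // n IHn; rewrite ltnS leq_eqVlt => /predU1P[<- //|/IHn].
  by rewrite expnS; lia.
by have := pow_gt _ Y_gt2; move: add2; rewrite /additionality; lia.
Qed.
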